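(* Let $d\ge3$ be an integer and fix $t\in(-1,1)$. For a $d$-tuple $(V_1,\dots,V_d)\in\mathcal{U}(d-1)^d$ define the associated matrices $$A_m=S^{-m+1}\begin{pmatrix}t&0\\0&V_m\end{pmatrix}S^{m-1}\in M_d(\mathbf{C}),\qquad m=1,\dots,d.$$ Suppose there is a unitary $W\in\mathcal{U}(d-1)$ such that, when $V_m=W$ for all $m$, the resulting set $\{A_m^*A_n\}_{m,n=1}^d$ is linearly independent. Then: (a) The set of $d$-tuples $(V_1,\dots,V_d)\in\mathcal{U}(d-1)^d$ for which the associated matrices satisfy that $\{A_m^*A_n\}_{m,n=1}^d$ is linearly independent is a co-null set with respect to the Haar measure on $\mathcal{U}(d-1)^d$. (b) Fix a partition $\{J_1,\dots,J_\kappa\}$ of $\{1,\dots,d\}$. For $(W_1,\dots,W_\kappa)\in\mathcal{U}(d-1)^\kappa$ let $(V_1,\dots,V_d)$ be given by $V_m=W_j$ when $m\in J_j$, and let $A_1,\dots,A_d$ be the matrices associated to $(V_1,\dots,V_d)$. The set of $\kappa$-tuples $(W_1,\dots,W_\kappa)\in\mathcal{U}(d-1)^\kappa$ for which $\{A_m^*A_n\}_{m,n=1}^d$ is linearly independent is a co-null set with respect to the Haar measure on $\mathcal{U}(d-1)^\kappa$. (c) The set of $V\in\mathcal{U}(d-1)$ such that, for the matrices $A_m$ associated to $V_1=\dots=V_d=V$, the set $\{A_m^*A_n\}_{m,n=1}^d$ is linearly independent is a co-null set with respect to the Haar measure on $\mathcal{U}(d-1)$. If, instead, there is a $W\in\mathcal{U}(d-1)$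 such that with all $V_m=W$ the set $\{A_mA_n^*\}_{m,n=1}^d$ is linearly independent, then conclusions (a), (b), (c) hold with $\{A_mA_n^*\}_{m,n=1}^d$ in place of $\{A_m^*A_n\}_{m,n=1}^d$.
   Context: $\mathcal{U}(k)$ is the group of unitary matrices in $M_k(\mathbf{C})$ and $\mathcal{U}(k)^r$ the group of $r$-tuples of them. $\{e_1,\dots,e_d\}$ is the standard basis of $\mathbf{C}^d$ and $S=\sum_{k=1}^d|e_k\rangle\langle e_{k+1}|$ (indices mod $d$) is the cyclic shift. A co-null set is a set whose complement has measure zero. Linear independence of $\{A_m^*A_n\}_{m,n}$ refers to the family of $d^2$ matrices indexed by pairs $(m,n)$. *)

(* Defs.v *)
From HB Require Import structures.
From mathcomp Require Import all_boot all_order all_algebra.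
From mathcomp Require Import spectral sesquilinear.
From mathcomp Require Import all_classical all_reals all_analysis.
From mathcomp Require Import complex.

Set Implicit Arguments.
Unset Strict Implicit.
Unset Printing Implicit Defensive.

Import Order.TTheory GRing.Theory Num.Theory.
Import numFieldNormedType.Exports.
Local Open Scope classical_set_scope.
Local Open Scope ring_scope.
Local Open Scope sesquilinear_scope.
Local Open Scope complex_scope.

HB.mixin Record isTopologicalGroup G
    & monoid.Group G & PointedTopological G := {
  mulg_continuous : continuous (fun p : G * G => (p.1 * p.2)%g) ;
  invg_continuous : continuous (fun x : G => (x^-1)%g)
}.

#[short(type="topologicalGroupType")]
HB.structure Definition TopologicalGroup :=
  {G of isTopologicalGroup G & monoid.Group G & PointedTopological G}.

Section MatrixConvergence.
Variables (T : topologicalType) (m n : nat).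

Lemma entry_continuous i j : continuous (fun N : 'M[T]_(m, n) => N i j).
Proof.
move=> M A MA; exists (fun i' j' => [set x | i' = i -> j' = j -> A x]).
  move=> i' j'; have [->|ni] := eqVneq i' i; last first.
    by apply: filterS filterT => x _ /= e; rewrite e eqxx in ni.
  have [->|nj] := eqVneq j' j; last first.
    by apply: filterS filterT => x _ /= _ e; rewrite e eqxx in nj.
  by apply: filterS MA => x Ax /=.
by move=> N /(_ i j) /=; exact.
Qed.

Lemma cvg_mx (F : set_system 'M[T]_(m, n)) (M : 'M[T]_(m, n)) :
  Filter F -> (forall i j, N i j @[N --> F] --> M i j) -> F --> M.
Proof.
move=> FF FM A [P MP PA]; apply: filterS PA _.
have : F [set N | forall ij : 'I_m * 'I_n, P ij.1 ij.2 (N ij.1 ij.2)].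
  by apply: filter_forall => -[i j] /=; apply: FM; exact: MP.
by apply: filterS => N h i j; exact: (h (i, j)).
Qed.

End MatrixConvergence.

Record unitary (C : numClosedFieldType) (k : nat) := Unitary {
  umx :> 'M[C]_k ;
  umxP : umx \is unitarymx
}.

HB.instance Definition _ C k := [isSub for @umx C k].
HB.instance Definition _ C k := [Choice of unitary C k by <:].

Section UnitaryGroup.
Variables (C : numClosedFieldType) (k : nat).
Local Notation U := (unitary C k).
Implicit Types A B : U.

Fact unitary1_subproof : (1%:M : 'M[C]_k) \is unitarymx.
Proof. by apply/unitarymxP; rewrite trmx1 map_mx1 mulmx1. Qed.

Fact unitaryM_subproof A B : (A *m B) \is unitarymx.
Proof. by apply: mul_unitarymx; apply: umxP. Qed.

Fact unitaryV_subproof A : (umx A ^t*) \is unitarymx.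
Proof. by rewrite trmxC_unitary umxP. Qed.

Definition unitary_one := Unitary unitary1_subproof.
Definition unitary_mul A B := Unitary (unitaryM_subproof A B).
Definition unitary_inv A := Unitary (unitaryV_subproof A).

Fact unitary_mulA : associative unitary_mul.
Proof. by move=> A B D; apply/val_inj; rewrite /= mulmxA. Qed.

Fact unitary_mul1 : left_id unitary_one unitary_mul.
Proof. by move=> A; apply/val_inj; rewrite /= mul1mx. Qed.

Fact unitary_mulr1 : right_id unitary_one unitary_mul.
Proof. by move=> A; apply/val_inj; rewrite /= mulmx1. Qed.

Fact unitary_mulV : left_inverse unitary_one unitary_inv unitary_mul.
Proof.
move=> A; apply/val_inj; rewrite /= -invmx_unitary ?umxP//.
by rewrite mulVmx// unitarymx_unit ?umxP.
Qed.

Fact unitary_mulrV : right_inverse unitary_one unitary_inv unitary_mul.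
Proof. by move=> A; apply/val_inj; rewrite /= (unitarymxP _) ?umxP. Qed.

HB.instance Definition _ := isGroup.Build U unitary_mulA unitary_mul1
  unitary_mulr1 unitary_mulV unitary_mulrV.

HB.instance Definition _ := isPointed.Build U unitary_one.

HB.instance Definition _ := Topological.copy U (initial_topology (@umx C k)).

Lemma cvg_unitary (X : Type) (F : set_system X) (f : X -> U) A : Filter F ->
  f x @[x --> F] --> A <->
  forall i j, umx (f x) i j @[x --> F] --> umx A i j.
Proof.
move=> FF; split=> [fA i j|fA].
  apply: (cvg_comp _ (fun M : 'M[C]_k => M i j)); last exact: entry_continuous.
  by apply: cvg_comp fA _; exact: initial_continuous.
have {}fA : umx (f x) @[x --> F] --> umx A by apply: cvg_mx.
move=> V [/= _ [[W oW <-]]] /= WA /filterS; apply; apply: fA.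
exact: open_nbhs_nbhs.
Qed.

Fact unitary_mul_continuous : continuous (fun p : U * U => (p.1 * p.2)%g).
Proof.
move=> [A B]; apply/cvg_unitary => i j.
have /cvg_unitary cvg1 : p.1 @[p --> (A, B)] --> A by exact: cvg_fst.
have /cvg_unitary cvg2 : p.2 @[p --> (A, B)] --> B by exact: cvg_snd.
rewrite /= mxE (_ : (fun _ => _) =
    (fun p : U * U => \sum_l umx p.1 i l * umx p.2 l j)); last first.
  by apply/funext => p; rewrite /= mxE.
by apply: cvg_big => [|l _]; [exact: add_continuous|exact: cvgM].
Qed.

Fact unitary_inv_continuous : continuous (fun A : U => (A^-1)%g).
Proof.
move=> A.
apply: (cvg_unitary (fun B : U => B^-1)%g _ (nbhs_filter (A : U))).2 => i j.
rewrite /= !mxE.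
rewrite (_ : (fun _ => _) = (fun B : U => Num.conj (umx B j i))); last first.
  by apply/funext => B; rewrite /= !mxE.
have /cvgrPdist_lt cA :=
  (cvg_unitary id A (nbhs_filter (A : U))).1 cvg_id j i.
apply/cvgrPdist_lt => e e0; have := cA e e0.
by apply: filterS => B; rewrite -rmorphB/= norm_conjC.
Qed.

HB.instance Definition _ :=
  isTopologicalGroup.Build U unitary_mul_continuous unitary_inv_continuous.

End UnitaryGroup.

(* Product topology; the group structure on {ffun I -> G} is pointwise. *)
HB.instance Definition _ (I : finType) (T : topologicalType) :=
  Topological.copy {ffun I -> T}
    (initial_topology (fun f : {ffun I -> T} => (f : {ptws I -> T}))).

HB.instance Definition _ (I : finType) (G : topologicalGroupType) :=
  isPointed.Build {ffun I -> G} 1%g.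

Section FinFunGroup.
Variables (I : finType) (G : topologicalGroupType).

Lemma cvg_ffun (X : Type) (F : set_system X) (f : X -> {ffun I -> G})
    (g : {ffun I -> G}) : Filter F ->
  f x @[x --> F] --> g <-> forall i, f x i @[x --> F] --> g i.
Proof.
move=> FF; split=> [fg i|fg].
  apply: (cvg_comp (fun x => f x : {ptws I -> G})
    (fun h : {ptws I -> G} => h i)); last exact: proj_continuous.
  by apply: cvg_comp fg _; exact: initial_continuous.
have {}fg : (f x : {ptws I -> G}) @[x --> F] --> (g : {ptws I -> G}).
  apply/cvg_sup => i V [/= _ [[W oW <-]]] /= Wg /filterS; apply; apply: fg.
  exact: open_nbhs_nbhs.
move=> V [/= _ [[W oW <-]]] /= Wg /filterS; apply; apply: fg.
exact: open_nbhs_nbhs.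
Qed.

Fact ffun_mul_continuous :
  continuous (fun p : {ffun I -> G} * {ffun I -> G} => (p.1 * p.2)%g).
Proof.
move=> [f g]; apply/cvg_ffun => i; rewrite /= ffunE.
rewrite (_ : (fun _ => _) =
    (fun p : {ffun I -> G} * {ffun I -> G} => (p.1 i * p.2 i)%g)); last first.
  by apply/funext => p; rewrite /= ffunE.
apply: (cvg_comp2 _ _ (mulg_continuous (f i, g i))).
  by move: i; apply/cvg_ffun; exact: cvg_fst.
by move: i; apply/cvg_ffun; exact: cvg_snd.
Qed.

Fact ffun_inv_continuous : continuous (fun f : {ffun I -> G} => (f^-1)%g).
Proof.
move=> f.
apply: (cvg_ffun (fun h : {ffun I -> G} => h^-1)%g _
  (nbhs_filter (f : {ffun I -> G}))).2 => i.
rewrite /= ffunE.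
rewrite (_ : (fun _ => _) = (fun h : {ffun I -> G} => ((h i)^-1)%g)); last first.
  by apply/funext => h; rewrite /= ffunE.
apply: (cvg_comp (fun h : {ffun I -> G} => h i) (fun x : G => x^-1)%g);
  last exact: (invg_continuous (f i)).
apply: (cvg_ffun id (f : {ffun I -> G}) (nbhs_filter (f : {ffun I -> G}))).1.
exact: cvg_id.
Qed.

HB.instance Definition _ := isTopologicalGroup.Build {ffun I -> G}
  ffun_mul_continuous ffun_inv_continuous.

End FinFunGroup.

Definition borel (T : ptopologicalType) := g_sigma_algebraType (@open T).

(* For a compact Hausdorff G, the normalized Haar measure is characterized by
   being a left-invariant Borel probability measure; no regularity condition is
   imposed because every finite Borel measure on U(k)^r is regular. *)
Definition haar_probability (R : realType) (G : topologicalGroupType)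
    (mu : probability (borel G) R) :=
  forall (g : G) (A : set (borel G)), measurable A ->
    mu [set (g * x)%g | x in A] = mu A.

(* A Borel set of full measure for every (hence, by uniqueness, for the)
   normalized Haar measure of G. *)
Definition conull (R : realType) (G : topologicalGroupType) (A : set G) :=
  measurable (~` A : set (borel G)) /\
  forall mu : probability (borel G) R, haar_probability mu -> mu (~` A) = 0%E.

(* delta_mx k (k+1) is |e_k><e_(k+1)|; ordS is the successor modulo d. *)
Definition cyclic_shift (C : numClosedFieldType) (d : nat) : 'M[C]_d :=
  \sum_(k < d) delta_mx k (ordS k).

(* The index m : 'I_n.+1 is 0-based: it stands for m + 1 in {1, .., d}, with
   d = n + 1, so the exponents -m+1 and m-1 become -m and m. *)
Definition assoc_mx (R : realType) (n : nat) (t : R)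
    (V : {ffun 'I_n.+1 -> unitary R[i] n}) (m : 'I_n.+1) : 'M[R[i]]_n.+1 :=
  let S := cyclic_shift R[i] n.+1 in
  S ^- m *m block_mx ((t%:C)%:M : 'M[R[i]]_1) 0 0 (V m) *m S ^+ m.

(* These are families indexed by pairs (m, n): free rejects repetitions. *)
Definition free_star_left (C : numClosedFieldType) (d : nat)
    (A : 'I_d -> 'M[C]_d) :=
  free [seq A m ^t* *m A n | m <- enum 'I_d, n <- enum 'I_d].

Definition free_star_right (C : numClosedFieldType) (d : nat)
    (A : 'I_d -> 'M[C]_d) :=
  free [seq A m *m A n ^t* | m <- enum 'I_d, n <- enum 'I_d].

(* Main.v *)
(** Linear independence of the d^2 matrices is the non-vanishing of a
    determinant f which is polynomial in the entries of the unitaries and their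
    conjugates. Let Z be the zero set of f and mu an invariant probability. The
    Cayley transform, times a phase, is a surjection Phi from a real vector
    space onto the group with rational entries, so for fixed x a single real
    parameter s of Phi(y) makes f(Phi(y) x) vanish for every s or for finitely
    many natural numbers s only. All sets {x | f(Phi(y) x) = 0} have measure
    mu(Z); replacing a parameter by 0, 1, 2, ... and taking the limit superior
    shows that the set of x for which f(Phi(y) x) vanishes whatever the value
    of this parameter has measure at least mu(Z). After all parameters have
    been freed, the set is {x | f(g x) = 0 for all g}, which is empty as soon
    as f is non-zero somewhere. *)
Require Import Defs.
From mathcomp Require Import all_boot all_order all_algebra.
From mathcomp Require Import spectral sesquilinear.
From mathcomp Require Import all_classical all_reals all_analysis.
From mathcomp Require Import complex lra.

Set Implicit Arguments.
Unset Strict Implicit.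
Unset Printing Implicit Defensive.

Import Order.TTheory GRing.Theory Num.Theory.
Import numFieldNormedType.Exports.
Local Open Scope classical_set_scope.
Local Open Scope ring_scope.
Local Open Scope complex_scope.
Local Open Scope sesquilinear_scope.

(** * Invariant probabilities and limits superior *)

Section HaarNull.
Variable R : realType.

(** The unions of the tails decrease to the limit superior, and continuity from above holds because
    a probability is finite. *)
Lemma measure_lim_sup_set_ge d (T : measurableType d) (mu : probability T R)
    (F : (set T)^nat) (m : \bar R) :
  (forall k, measurable (F k)) -> (forall k, (m <= mu (F k))%E) ->
  (m <= mu (lim_sup_set F))%E.
Proof.
move=> mF Fm.
have mU n : measurable (\bigcup_(k >= n) F k) by exact: bigcup_measurable.
have cF : mu (\bigcup_(k >= n) F k) @[n --> \oo] --> mu (lim_sup_set F).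
  apply: lim_sup_set_cvg => //.
  by apply: le_lt_trans (probability_le1 mu (mU 0%N)) _; rewrite ltry.
rewrite -(cvg_lim _ cF)//; apply: lime_ge.
  by apply/cvg_ex; eexists; exact: cF.
apply: nearW => n; apply: le_trans (Fm n) _; apply: le_measure; rewrite ?inE//.
by apply: bigcup_sup => /=.
Qed.

Lemma closed_measurable_borel (T : ptopologicalType) (A : set T) :
  closed A -> measurable (A : set (borel T)).
Proof.
move=> /closed_openC oA; rewrite -(setCK A); apply: measurableC.
exact: sub_sigma_algebra.
Qed.

(* One parameter is freed at a time: the set obtained by letting it vary
   contains the limit superior of the sets obtained at natural values. *)
Lemma measure_bigcap_ge (P : finType) (T : ptopologicalType)
    (mu : probability (borel T) R) (E : (P -> R) -> set T) (m : \bar R) :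
  (forall y, closed (E y)) -> (forall y, (m <= mu (E y))%E) ->
  (forall y p x, ~ E y x -> \forall k \near \oo,
    ~ E [eta y with p |-> k%:R] x) ->
  (m <= mu (\bigcap_y E y))%E.
Proof.
move=> cE mE nE.
(* The parameters in [l] vary freely, the others stay as in [y]; at [l = enum P] nothing is fixed
   any more. *)
pose B (l : seq P) (y : P -> R) :=
  [set x | forall y' : P -> R, {in predC (mem l), y' =1 y} -> E y' x].
(* Closed sets are stable under uncountable intersections, whence the measurability of each
   [B l y]. *)
have cB l y : closed (B l y).
  rewrite (_ : B l y =
      \bigcap_(y' in [set y' : P -> R | {in predC (mem l), y' =1 y}]) E y').
    by apply: closed_bigI => y' _; exact: cE.
  by apply/seteqP; split => x Bx y' yy'; exact: Bx.
suff mB l y : (m <= mu (B l y))%E.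
  rewrite (_ : \bigcap_y _ = B (enum P) (fun=> 0)); first exact: mB.
  apply/seteqP; split => [x Ex y _|x Bx y _]; first exact: Ex.
  by apply: Bx => p; rewrite inE /= mem_enum inE.
elim: l y => [|p l IHl] y.
  rewrite (_ : B [::] y = E y)//; apply/seteqP; split => [x|x Ex y' yy'].
    by apply.
  by rewrite (_ : y' = y)//; apply/funext => p; exact: yy'.
have mm k : (m <= mu (B l [eta y with p |-> k%:R]))%E := IHl _.
apply: (le_trans (measure_lim_sup_set_ge _ mm)) => [k|].
  exact: closed_measurable_borel.
apply: le_measure; rewrite ?inE.
- apply: bigcap_measurable => // k _; apply: bigcup_measurable => i _.
  exact: closed_measurable_borel.
- exact: closed_measurable_borel.
(* Were [E y' x] false, it would remain false for all large values [k] of the parameter [p]; but [x]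
   lies in the set of index [k] for infinitely many [k]. *)
move=> x limx y' yy'; apply: contrapT => /(nE _ p) [N _ nEx].
have [k /= Nk] := limx N I.
move=> /(_ [eta y' with p |-> k%:R]) Ex; apply: (nEx k Nk); apply: Ex => q.
rewrite inE /= => ql.
by case: eqP => // /eqP qp; apply: yy'; rewrite !inE negb_or qp.
Qed.

(* By invariance all the translates of [Z] by the [Phi y] have the measure of
   [Z], while their intersection is empty. *)
Lemma conull_setC (P : finType) (G : topologicalGroupType)
    (Phi : (P -> R) -> G) (Z : set G) :
  closed Z -> (forall g, exists y, Phi y = g) -> (exists g, ~ Z g) ->
  (forall y p x, ~ Z (Phi y * x)%g -> \forall k \near \oo,
    ~ Z (Phi [eta y with p |-> k%:R] * x)%g) ->
  conull R (~` Z).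
Proof.
move=> cZ surj [g0 Zg0] nZ; rewrite /conull setCK.
split=> [|mu haar]; first exact: closed_measurable_borel.
pose E y := [set x | Z (Phi y * x)%g].
have EE y : E y = [set ((Phi y)^-1 * x)%g | x in Z].
  apply/seteqP; split => [x Ex|_ [x Zx <-]].
    by exists (Phi y * x)%g; rewrite // mulKg.
  by rewrite /E /= mulVKg.
have cE y : closed (E y).
  apply: (closed_comp _ cZ) => x _; apply: cvg_comp2 (mulg_continuous (_, _)).
    exact: cvg_cst.
  exact: cvg_id.
have mE y : (mu Z <= mu (E y))%E.
  by rewrite EE haar//; exact: closed_measurable_borel.
have := measure_bigcap_ge cE mE (fun y p x => nZ y p x).
rewrite (_ : \bigcap_y _ = set0) ?measure0 => [Z0|].
  by apply/eqP; rewrite eq_le Z0 measure_ge0.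
apply/seteqP; split => // x Ex; apply: Zg0.
(* Some [Phi y] carries [x] to [g0], which is outside [Z]. *)
have [y Ey] := surj (g0 * x^-1)%g.
by have := Ex y I; rewrite /E /= Ey mulgVK.
Qed.

End HaarNull.

(** * Function rings stable under complex conjugation *)

Record conj_ring (T : Type) (C : numClosedFieldType)
    (Q : (T -> C) -> Prop) : Prop :=
  ConjRing {
    conj_ring_cst : forall c, Q (fun=> c) ;
    conj_ringD : forall f g, Q f -> Q g -> Q (fun x => f x + g x) ;
    conj_ringM : forall f g, Q f -> Q g -> Q (fun x => f x * g x) ;
    conj_ringC : forall f, Q f -> Q (fun x => Num.conj (f x))
  }.

Definition mx_in (T : Type) (C : numClosedFieldType) (Q : (T -> C) -> Prop)
    (m n : nat) (M : T -> 'M[C]_(m, n)) :=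
  forall i j, Q (fun x => M x i j).

Section ConjRing.
Variables (T : Type) (C : numClosedFieldType) (Q : (T -> C) -> Prop).
Hypothesis hQ : conj_ring Q.

Lemma conj_ring_sum (I : Type) (r : seq I) (F : I -> T -> C) :
  (forall i, Q (F i)) -> Q (fun x => \sum_(i <- r) F i x).
Proof.
move=> QF; elim: r => [|i r IHr].
  by under eq_fun do rewrite big_nil; exact: conj_ring_cst.
by under eq_fun do rewrite big_cons; exact: conj_ringD.
Qed.

Lemma conj_ring_prod (I : Type) (r : seq I) (F : I -> T -> C) :
  (forall i, Q (F i)) -> Q (fun x => \prod_(i <- r) F i x).
Proof.
move=> QF; elim: r => [|i r IHr].
  by under eq_fun do rewrite big_nil; exact: conj_ring_cst.
by under eq_fun do rewrite big_cons; exact: conj_ringM.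
Qed.

Lemma mx_in_cst m n (A : 'M[C]_(m, n)) : mx_in Q (fun=> A).
Proof. by move=> i j; exact: conj_ring_cst. Qed.

Lemma mx_inD m n (A B : T -> 'M[C]_(m, n)) :
  mx_in Q A -> mx_in Q B -> mx_in Q (fun x => A x + B x).
Proof.
by move=> QA QB i j; under eq_fun do rewrite mxE; exact: conj_ringD.
Qed.

Lemma mx_inZ m n (a : T -> C) (A : T -> 'M[C]_(m, n)) :
  Q a -> mx_in Q A -> mx_in Q (fun x => a x *: A x).
Proof.
by move=> Qa QA i j; under eq_fun do rewrite mxE; exact: conj_ringM.
Qed.

Lemma mx_inN m n (A : T -> 'M[C]_(m, n)) :
  mx_in Q A -> mx_in Q (fun x => - A x).
Proof.
move=> QA; under eq_fun do rewrite -scaleN1r.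
by apply: mx_inZ => //; exact: conj_ring_cst.
Qed.

Lemma mx_inM m n p (A : T -> 'M[C]_(m, n)) (B : T -> 'M[C]_(n, p)) :
  mx_in Q A -> mx_in Q B -> mx_in Q (fun x => A x *m B x).
Proof.
move=> QA QB i j; under eq_fun do rewrite mxE.
by apply: conj_ring_sum => k; exact: conj_ringM.
Qed.

Lemma mx_in_trC m n (A : T -> 'M[C]_(m, n)) :
  mx_in Q A -> mx_in Q (fun x => A x ^t*).
Proof.
by move=> QA i j; under eq_fun do rewrite !mxE; exact: conj_ringC.
Qed.

Lemma mx_in_block m1 m2 n1 n2
    (A : T -> 'M[C]_(m1, n1)) (B : T -> 'M[C]_(m1, n2))
    (D : T -> 'M[C]_(m2, n1)) (E : T -> 'M[C]_(m2, n2)) :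
  mx_in Q A -> mx_in Q B -> mx_in Q D -> mx_in Q E ->
  mx_in Q (fun x => block_mx (A x) (B x) (D x) (E x)).
Proof.
move=> QA QB QD QE i j; rewrite -(splitK i) -(splitK j).
case: (fintype.split i) => i'; case: (fintype.split j) => j' /=.
- by under eq_fun do rewrite block_mxEul.
- by under eq_fun do rewrite block_mxEur.
- by under eq_fun do rewrite block_mxEdl.
- by under eq_fun do rewrite block_mxEdr.
Qed.

Lemma conj_ring_det n (A : T -> 'M[C]_n) :
  mx_in Q A -> Q (fun x => \det (A x)).
Proof.
move=> QA; apply: conj_ring_sum => s; apply: conj_ringM => //.
  exact: conj_ring_cst.
by apply: conj_ring_prod => i; exact: QA.
Qed.

Lemma mx_in_adj n (A : T -> 'M[C]_n) :
  mx_in Q A -> mx_in Q (fun x => \adj (A x)).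
Proof.
move=> QA i j; under eq_fun do rewrite mxE; apply: conj_ringM => //.
  exact: conj_ring_cst.
apply: conj_ring_det => k l.
by under eq_fun do rewrite !mxE; exact: QA.
Qed.

End ConjRing.

(** * Linear independence as a determinant *)

Section FreeFamily.
Variables (C : numClosedFieldType) (d : nat).
Variable (op : 'M[C]_d -> 'M[C]_d -> 'M[C]_d).

(** An abstract [op] serves both [A ^t* *m B] and [A *m B ^t*]. *)
Definition op_family (A : 'I_d -> 'M[C]_d) :=
  [seq op (A m) (A n) | m <- enum 'I_d, n <- enum 'I_d].

Definition op_family_mx (A : 'I_d -> 'M[C]_d) : 'M[C]_(d * d) :=
  \matrix_k mxvec (op_family A)`_k.

(** The [d * d] matrices live in a space of that same dimension, so their coordinate rows form a
    square matrix, and independence is its invertibility. *)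
Lemma free_op_familyE A : free (op_family A) = (\det (op_family_mx A) != 0).
Proof.
have sX : size (op_family A) == (d * d)%N.
  by rewrite size_allpairs -cardE card_ord.
rewrite -unitfE -unitmxE -row_free_unit (_ : op_family A = Tuple sX)//.
have lin k : \sum_(i < d * d) k i *: (Tuple sX)`_i =
    vec_mx (\row_i k i *m op_family_mx A).
  rewrite mulmx_sum_row linear_sum; apply: eq_bigr => i _.
  by rewrite linearZ /= rowK mxvecK mxE.
apply/freeP/idP => [fX|fX k].
  apply: inj_row_free => v vA0; apply/rowP => i; rewrite mxE.
  apply: (fX (v 0)); rewrite lin (_ : \row_i v 0 i = v) ?vA0 ?linear0//.
  by apply/rowP => j; rewrite mxE.
rewrite lin => /(congr1 mxvec); rewrite vec_mxK linear0 => kA0 i.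
have /(row_free_inj fX) /rowP /(_ i) :
    \row_i k i *m op_family_mx A = 0 *m op_family_mx A.
  by rewrite kA0 mul0mx.
by rewrite !mxE.
Qed.

Lemma mx_in_op_family_mx (T : Type) (Q : (T -> C) -> Prop)
    (A : T -> 'I_d -> 'M[C]_d) :
  (forall m n, mx_in Q (fun x => op (A x m) (A x n))) ->
  mx_in Q (fun x => op_family_mx (A x)).
Proof.
move=> QA k l; case/mxvec_indexP: l => i j.
under eq_fun do rewrite mxE mxvecE.
have XE x : op_family (A x) = [seq op (A x p.1) (A x p.2) |
    p <- [seq (m, n) | m <- enum 'I_d, n <- enum 'I_d]].
  by rewrite map_allpairs.
(* The pair at position [k] does not depend on [x]; the head [p0] of the list of pairs serves as
   default value for [nth]. *)
have [p pE] : exists p, forall x, (op_family (A x))`_k = op (A x p.1) (A x p.2).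
  have : (k < size [seq (m, n) | m <- enum 'I_d, n <- enum 'I_d])%N.
    by rewrite size_allpairs -cardE card_ord.
  case: [seq (m, n) | m <- _, n <- _] XE => // p0 s XE ks.
  by exists (nth p0 (p0 :: s) k) => x; rewrite XE (nth_map p0).
by under eq_fun do rewrite pE; exact: QA.
Qed.

End FreeFamily.

(** * Rational functions of one real parameter *)

Section Rational.
Variable R : realType.
Local Notation C := R[i].

Definition rational_fun (h : R -> C) := exists p q : {poly C},
  (forall s : R, q.[s%:C] != 0) /\ (forall s : R, h s = p.[s%:C] / q.[s%:C]).

(** A real argument is fixed by conjugation, which then acts on the coefficients alone; hence
    conjugates of rational functions are rational. *)
Lemma horner_conj (p : {poly C}) (s : R) :
  (map_poly Num.conj p).[s%:C] = Num.conj p.[s%:C].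
Proof.
rewrite -[X in _.[X]](_ : Num.conj s%:C = s%:C) ?horner_map//.
by apply/CrealP; rewrite complex_real.
Qed.

Lemma conj_ring_rational : conj_ring rational_fun.
Proof.
split.
- by move=> c; exists c%:P, 1; split=> s; rewrite !hornerE ?oner_eq0 ?divr1.
- move=> f g [p [q [q0 fE]]] [p' [q' [q'0 gE]]].
  exists (p * q' + p' * q), (q * q'); split=> s; rewrite !hornerE.
    by rewrite mulf_neq0.
  by rewrite fE gE addf_div.
- move=> f g [p [q [q0 fE]]] [p' [q' [q'0 gE]]].
  exists (p * p'), (q * q'); split=> s; rewrite !hornerE.
    by rewrite mulf_neq0.
  by rewrite fE gE mulf_div.
- move=> f [p [q [q0 fE]]]; exists (map_poly Num.conj p), (map_poly Num.conj q).
  split=> s; rewrite !horner_conj; first by rewrite fmorph_eq0.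
  by rewrite fE fmorph_div.
Qed.

Lemma rational_fun_real : rational_fun (fun s => s%:C).
Proof. by exists 'X, 1; split=> s; rewrite !hornerE ?oner_eq0 ?divr1. Qed.

Lemma rational_funV (h : R -> C) : (forall s, h s != 0) ->
  rational_fun h -> rational_fun (fun s => (h s)^-1).
Proof.
move=> h0 [p [q [q0 hE]]]; exists q, p; split=> s; last by rewrite hE invf_div.
by apply: contra (h0 s) => /eqP p0; rewrite hE p0 mul0r.
Qed.

Lemma mx_in_rational_inv n (A : R -> 'M[C]_n) : (forall s, A s \in unitmx) ->
  mx_in rational_fun A -> mx_in rational_fun (fun s => invmx (A s)).
Proof.
move=> uA rA.
rewrite (_ : (fun _ => _) =
    (fun s => (\det (A s))^-1 *: \adj (A s))); last first.
  by apply/funext => s; rewrite /invmx uA.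
apply: (mx_inZ conj_ring_rational).
  apply: rational_funV => [s|]; first by rewrite -unitfE -unitmxE.
  exact: (conj_ring_det conj_ring_rational).
exact: (mx_in_adj conj_ring_rational).
Qed.

(** A non-zero polynomial has finitely many roots, and the injective [w] meets each of them at most
    once. *)
Lemma poly_near_neq0 (w : nat -> C) (p : {poly C}) : injective w -> p != 0 ->
  \forall k \near \oo, p.[w k] != 0.
Proof.
move=> w_inj p0; have [r ->] := closed_field_poly_normal p.
suff : \forall k \near \oo, w k \notin r.
  apply: filterS => k wr; rewrite hornerZ mulf_neq0 ?lead_coef_eq0//.
  by rewrite -[_ == 0]/(root _ _) root_prod_XsubC.
elim: r => [|z r IHr]; first exact: nearW.
suff wz : \forall k \near \oo, w k != z.
  by apply: filterS2 wz IHr => k; rewrite inE negb_or => -> ->.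
have [[j wj]|nw] := pselect (exists j, w j = z).
  exists j.+1 => // k /= jk; rewrite -wj (inj_eq w_inj).
  by rewrite neq_ltn jk orbT.
by apply: nearW => k; apply/eqP => wk; apply: nw; exists k.
Qed.

(** One non-zero value shows that the numerator is not the zero polynomial. *)
Lemma rational_near_neq0 (h : R -> C) (s : R) : rational_fun h -> h s != 0 ->
  \forall k \near \oo, h k%:R != 0.
Proof.
move=> [p [q [q0 hE]]] hs.
have p0 : p != 0 by apply: contra hs => /eqP p0; rewrite hE p0 horner0 mul0r.
have inj : injective (fun k : nat => (k%:R : R)%:C).
  by move=> k l /complexI/eqP; rewrite eqr_nat => /eqP.
have := poly_near_neq0 inj p0; apply: filterS => k pk.
by rewrite hE mulf_neq0// invr_eq0.
Qed.

End Rational.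

(** * The Cayley transform *)

Section Cayley.
Variables (C : numClosedFieldType) (n : nat).

Lemma trCM (m k l : nat) (A : 'M[C]_(m, k)) (B : 'M[C]_(k, l)) :
  (A *m B) ^t* = B ^t* *m A ^t*.
Proof. by rewrite trmx_mul map_mxM. Qed.

Lemma trCB (m k : nat) (A B : 'M[C]_(m, k)) : (A - B) ^t* = A ^t* - B ^t*.
Proof. by rewrite linearB /= map_mxB. Qed.

Lemma trCD (m k : nat) (A B : 'M[C]_(m, k)) : (A + B) ^t* = A ^t* + B ^t*.
Proof. by rewrite linearD /= map_mxD. Qed.

Lemma trCN (m k : nat) (A : 'M[C]_(m, k)) : (- A) ^t* = - (A ^t*).
Proof. by rewrite linearN /= map_mxN. Qed.

Lemma trC1 : (1%:M : 'M[C]_n) ^t* = 1%:M.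
Proof. by rewrite trmx1 map_mx1. Qed.

Lemma trCinv (A : 'M[C]_n) : (invmx A) ^t* = invmx (A ^t*).
Proof. by rewrite trmx_inv map_invmx. Qed.

(** By [skew_half] every skew-Hermitian matrix arises in this way, so the entries of [Y] are
    unconstrained parameters. *)
Definition skew_part (Y : 'M[C]_n) := Y - Y ^t*.

Lemma skew_part_trC Y : (skew_part Y) ^t* = - skew_part Y.
Proof. by rewrite /skew_part trCB trmxCK opprB. Qed.

Lemma skew_half (X : 'M[C]_n) : X ^t* = - X -> skew_part (2^-1 *: X) = X.
Proof.
move=> Xskew; rewrite /skew_part linearZ /= map_mxZ Xskew fmorphV rmorph_nat.
by rewrite scalerN opprK -scalerDl -div1r -splitr scale1r.
Qed.

(** If [v + v *m X = 0], then [v *m X *m v ^t*] is minus the squared norm of [v], a real number,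
    while skewness makes it opposite to its own conjugate; so [v = 0]. *)
Lemma unitmx_1Dskew (X : 'M[C]_n) : X ^t* = - X -> 1%:M + X \in unitmx.
Proof.
move=> Xskew; rewrite -row_free_unit; apply: inj_row_free => v.
rewrite mulmxDr mulmx1 => /(canRL (addKr _)); rewrite addr0 => vX.
have vXv : v *m X *m v ^t* = - (v *m v ^t*) by rewrite vX mulNmx.
have /(congr1 (fun M => M ^t*)) := vXv.
rewrite !trCM trmxCK Xskew mulNmx mulmxN mulmxA vXv opprK.
rewrite trCN trCM trmxCK => /eqP.
rewrite -addr_eq0 -mulr2n -scaler_nat scaler_eq0 pnatr_eq0 /= => /eqP vv0.
by apply/eqP; apply: contraT => /dotmx_is_dotmx; rewrite dotmxE vv0 mxE ltxx.
Qed.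

Lemma comm_cayley (X : 'M[C]_n) : 1%:M + X \in unitmx ->
  comm_mx (1%:M - X) (invmx (1%:M + X)).
Proof.
move=> uX; have com : comm_mx (1%:M - X) (1%:M + X).
  apply: comm_mxD; first exact: comm_mx1.
  by apply: comm_mx_sym; apply: comm_mxB => //; exact: comm_mx1.
apply: (canRL (mulKmx uX)).
by rewrite mulmxA -com mulmxK.
Qed.

Definition cayley (X : 'M[C]_n) := (1%:M - X) *m invmx (1%:M + X).

Lemma cayley_unitary X : X ^t* = - X -> cayley X \is unitarymx.
Proof.
move=> Xskew; have u1 := unitmx_1Dskew Xskew.
have u2 : 1%:M - X \in unitmx.
  by apply: unitmx_1Dskew; rewrite trCN Xskew.
have com := comm_cayley u1.
apply/unitarymxP; rewrite /cayley trCM trCinv trCB trCD trC1 Xskew.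
rewrite opprK com mulmxA -(mulmxA _ _ (invmx (1%:M - X))) mulmxV// mulmx1.
by rewrite mulVmx.
Qed.

(** The Cayley transform is its own inverse, so [cayley h] is the witness. *)
Lemma cayleyK (h : 'M[C]_n) : h \is unitarymx -> 1%:M + h \in unitmx ->
  exists2 X, X ^t* = - X & cayley X = h.
Proof.
move=> /unitarymxP hh uN; set N := 1%:M + h in uN.
have h'h : h ^t* *m h = 1%:M by apply: mulmx1C.
have comN := comm_cayley uN.
have uh : h ^t* \in unitmx by apply: (mulmx1_unit h'h).1.
exists (cayley h).
  (* Up to sign, the adjoints of [N] and [1%:M - h] are these matrices multiplied by [h ^t*], a
     factor that cancels in the quotient. *)
  have N' : N ^t* = h ^t* *m N.
    by rewrite /N trCD trC1 mulmxDr mulmx1 h'h addrC.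
  have D' : (1%:M - h) ^t* = - (h ^t* *m (1%:M - h)).
    by rewrite trCB trC1 mulmxBr mulmx1 h'h opprB.
  rewrite /cayley trCM trCinv N' D' mulmxN; congr (- _).
  rewrite comN; apply: (canLR (mulKmx _)); first by rewrite unitmx_mul uh.
  by rewrite -mulmxA (mulKVmx uN).
have mE : 1%:M - cayley h = 2 *: h *m invmx N.
  rewrite -[1%:M](mulmxV uN) -mulmxBl; congr (_ *m _).
  by rewrite /N opprB [h - _]addrC addrACA subrr add0r scaler_nat.
have pE : 1%:M + cayley h = 2 *: invmx N.
  have N2 : N + (1%:M - h) = 2 *: 1%:M.
    by rewrite /N addrACA subrr addr0 scaler_nat.
  by rewrite -[1%:M](mulmxV uN) -mulmxDl N2 -scalemxAl mul1mx.
have u2 : (2 : C) != 0 by rewrite pnatr_eq0.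
rewrite [LHS]/cayley mE pE invmxZ ?unitmxZ ?unitfE ?unitmx_inv// invmxK.
by rewrite -scalemxAr -!scalemxAl mulmxKV// scalerA mulVf// scale1r.
Qed.

End Cayley.

(** * Rational parametrization of the unitary group *)

Section UnitaryParam.
Variables (R : realType) (n : nat).
Local Notation C := R[i].

(** A rational parametrization of the unit circle without -1. *)
Definition phase (s : R) : C := (1 + 'i%C * s%:C) / (1 - 'i%C * s%:C).

Lemma phase_den_neq0 (s : R) : 1 - 'i%C * s%:C != 0 :> C.
Proof. by rewrite eq_complex /= !(mul0r, mulr0, subr0, oner_eq0). Qed.

Lemma phase_conj (s : R) : phase s * Num.conj (phase s) = 1.
Proof.
have conjE (x : C) : Num.conj x = conjc x by [].
have num : Num.conj (1 + 'i%C * s%:C) = 1 - 'i%C * s%:C :> C.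
  by rewrite conjE; simpc.
have den : Num.conj (1 - 'i%C * s%:C) = 1 + 'i%C * s%:C :> C.
  by rewrite -num conjCK.
have d0 := phase_den_neq0 s.
have n0 : 1 + 'i%C * s%:C != 0 :> C by rewrite -den fmorph_eq0.
by rewrite /phase fmorph_div /= num den mulrA divfK// divff.
Qed.

Lemma phase_neq0 (s : R) : phase s != 0.
Proof.
by apply: contra_eq_neq (phase_conj s) => ->; rewrite mul0r eq_sym oner_eq0.
Qed.

Lemma phase_inj : injective phase.
Proof.
move=> s s' /eqP; rewrite /phase eqr_div ?phase_den_neq0// => /eqP.
by simpc => -[_]; lra.
Qed.

Lemma rational_phase : rational_fun phase.
Proof.
have rR := conj_ring_rational R.
have ris : rational_fun (fun s : R => 'i%C * s%:C).
  apply: (conj_ringM rR); first exact: (conj_ring_cst rR).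
  exact: rational_fun_real.
have rN1 : rational_fun (fun s : R => - 1 * ('i%C * s%:C)).
  by apply: (conj_ringM rR) => //; exact: (conj_ring_cst rR).
apply: (conj_ringM rR).
  by apply: (conj_ringD rR) => //; exact: (conj_ring_cst rR).
apply: rational_funV => [s|]; first exact: phase_den_neq0.
under eq_fun do rewrite -mulN1r.
by apply: (conj_ringD rR) => //; exact: (conj_ring_cst rR).
Qed.

Lemma unitary_scale (a : C) (A : 'M[C]_n) : a * Num.conj a = 1 ->
  A \is unitarymx -> a *: A \is unitarymx.
Proof.
move=> a1 /unitarymxP AA; apply/unitarymxP.
by rewrite linearZ /= map_mxZ -scalemxAl -scalemxAr scalerA a1 scale1r.
Qed.

(* The real and imaginary parts of the entries of a matrix, and one more
   coordinate for the phase. *)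
Definition uparam := option ('I_n * 'I_n * bool).

Definition uparam_mx (y : uparam -> R) : 'M[C]_n :=
  \matrix_(i, j) (y (Some (i, j, false)) +i* y (Some (i, j, true))).

Definition unitary_param (y : uparam -> R) : unitary C n :=
  Unitary (unitary_scale (phase_conj (y None))
    (cayley_unitary (skew_part_trC (uparam_mx y)))).

(* The phase avoids the unitaries with eigenvalue -1, which are not Cayley
   transforms. *)
Lemma unitary_param_surj (g : unitary C n) : exists y, unitary_param y = g.
Proof.
have w_inj : injective (fun k : nat => - phase k%:R).
  by move=> k l /oppr_inj /phase_inj /eqP; rewrite eqr_nat => /eqP.
have char0 := monic_neq0 (char_poly_monic (umx g)).
(* With [- phase k] chosen off the finitely many eigenvalues of [g], -1 is no eigenvalue of [g]
   divided by [phase k]. *)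
have [k gk] := filter_ex (poly_near_neq0 w_inj char0).
set a := phase k%:R in gk; have a0 : a != 0 := phase_neq0 _.
have uh : a^-1 *: umx g \is unitarymx.
  apply: unitary_scale; last exact: umxP.
  by rewrite fmorphV -invfM phase_conj invr1.
have uN : 1%:M + a^-1 *: umx g \in unitmx.
  rewrite -row_free_unit; apply: inj_row_free => v.
  rewrite mulmxDr mulmx1 -scalemxAr => /eqP; rewrite addrC addr_eq0 => /eqP vg.
  apply: contraNeq gk => v0; apply/eqP/rootP.
  rewrite -eigenvalue_root_char; apply/eigenvalueP; exists v => //.
  by rewrite scaleNr -scalerN -vg scalerA divff// scale1r.
have [X Xskew Xh] := cayleyK uh uN.
pose Y : 'M[C]_n := 2^-1 *: X.
exists (fun p => if p is Some (i, j, b) then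
  (if b then complex.Im (Y i j) else complex.Re (Y i j)) else k%:R).
apply/val_inj; rewrite /= (_ : uparam_mx _ = Y); last first.
  by apply/matrixP => i j; rewrite [LHS]mxE; case: (Y i j).
by rewrite skew_half// Xh scalerA divff// scale1r.
Qed.

(** The inverse in the Cayley transform creates no pole, by [unitmx_1Dskew]. *)
Lemma rational_unitary_param (y : uparam -> R) (p : uparam) :
  mx_in (@rational_fun R) (fun s => umx (unitary_param [eta y with p |-> s])).
Proof.
have rR := conj_ring_rational R.
have ry q : rational_fun (fun s => ([eta y with p |-> s] q)%:C).
  rewrite /=; case: eqP => _; first exact: rational_fun_real.
  exact: (conj_ring_cst rR).
have rphase : rational_fun (fun s => phase ([eta y with p |-> s] None)).
  rewrite /=; case: eqP => _; first exact: rational_phase.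
  exact: (conj_ring_cst rR).
have rX : mx_in (@rational_fun R)
    (fun s => skew_part (uparam_mx [eta y with p |-> s])).
  have rY : mx_in (@rational_fun R) (fun s => uparam_mx [eta y with p |-> s]).
    move=> i j; under eq_fun do rewrite mxE [_ +i* _]complexE /=.
    apply: (conj_ringD rR); first exact: ry.
    by apply: (conj_ringM rR); [exact: (conj_ring_cst rR)|exact: ry].
  by apply: (mx_inD rR) => //; apply: (mx_inN rR); exact: (mx_in_trC rR).
apply: (mx_inZ rR) => //; apply: (mx_inM rR).
  by apply: (mx_inD rR); [exact: (mx_in_cst rR)|exact: (mx_inN rR)].
apply: mx_in_rational_inv => [s|]; last first.
  by apply: (mx_inD rR) => //; exact: (mx_in_cst rR).
by apply: unitmx_1Dskew; exact: skew_part_trC.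
Qed.

End UnitaryParam.

(** * Continuity of the matrix entries *)

Section ContinuousFun.
Variables (T : topologicalType) (C : numClosedFieldType).

Definition continuous_fun (f : T -> C) := continuous f.

Lemma conj_ring_continuous : conj_ring continuous_fun.
Proof.
split=> [c x|f g cf cg x|f g cf cg x|f cf x].
- exact: cvg_cst.
- exact: cvgD (cf x) (cg x).
- exact: cvgM (cf x) (cg x).
- have /cvgrPdist_lt cfx := cf x; apply/cvgrPdist_lt => e e0; have := cfx e e0.
  by apply: filterS => z; rewrite -rmorphB /= norm_conjC.
Qed.

Lemma closed_continuous_fun0 (f : T -> C) :
  continuous_fun f -> closed [set x | f x = 0].
Proof.
move=> cf; apply: (closed_comp (f := f) (D := [set 0])) => [x _|].
  exact: cf.
apply/accessible_closed_set1/hausdorff_accessible.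
exact: (@norm_hausdorff C C^o).
Qed.

End ContinuousFun.

Lemma continuous_unitary_entry (C : numClosedFieldType) (n : nat) :
  mx_in (@continuous_fun (unitary C n) C) (@umx C n).
Proof.
move=> i j x.
exact: ((cvg_unitary id x (nbhs_filter (x : unitary C n))).1 cvg_id i j).
Qed.

Lemma continuous_ffun_unitary_entry (C : numClosedFieldType) (n : nat)
    (I : finType) (i : I) :
  mx_in (@continuous_fun {ffun I -> unitary C n} C) (fun W => umx (W i)).
Proof.
move=> k l x.
apply: (cvg_comp (fun W : {ffun I -> unitary C n} => W i)
  (fun A : unitary C n => umx A k l)).
  exact: ((cvg_ffun id x (nbhs_filter (x : {ffun I -> unitary C n}))).1 cvg_id).
exact: continuous_unitary_entry.
Qed.

(** * Co-null sets of independent families *)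

Section ConullFree.
Variables (R : realType) (n : nat) (t : R).
Local Notation C := R[i].
Local Notation U := (unitary C n).

Variable op : 'M[C]_n.+1 -> 'M[C]_n.+1 -> 'M[C]_n.+1.
Hypothesis mx_in_op : forall (T : Type) (Q : (T -> C) -> Prop), conj_ring Q ->
  forall A B, mx_in Q A -> mx_in Q B -> mx_in Q (fun x => op (A x) (B x)).

Definition assoc_det (V : {ffun 'I_n.+1 -> U}) :=
  \det (op_family_mx op (assoc_mx t V)).

(** This is used for two rings: continuous functions, to make the zero set closed, and rational
    functions, to control the zeros along one parameter. *)
Lemma conj_ring_assoc_det (T : Type) (Q : (T -> C) -> Prop)
    (V : T -> {ffun 'I_n.+1 -> U}) : conj_ring Q ->
  (forall m, mx_in Q (fun x => umx (V x m))) -> Q (fun x => assoc_det (V x)).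
Proof.
move=> hQ QV; have Qassoc m : mx_in Q (fun x => assoc_mx t (V x) m).
  apply: (mx_inM hQ); last exact: (mx_in_cst hQ).
  apply: (mx_inM hQ); first exact: (mx_in_cst hQ).
  by apply: (mx_in_block (m1 := 1) (n1 := 1)) => //; exact: (mx_in_cst hQ).
apply: (conj_ring_det hQ); apply: mx_in_op_family_mx => m m'.
exact: mx_in_op.
Qed.

Lemma free_assocE (V : {ffun 'I_n.+1 -> U}) :
  free (op_family op (assoc_mx t V)) = (assoc_det V != 0).
Proof. exact: free_op_familyE. Qed.

(** [G] is the group that carries the measure and [V] builds a tuple from its points; the
    conclusions differ only in this choice. *)
Lemma conull_free (P : finType) (G : topologicalGroupType)
    (Phi : (P -> R) -> G) (V : G -> {ffun 'I_n.+1 -> U}) :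
  (forall g, exists y, Phi y = g) ->
  (forall m, mx_in (@continuous_fun G C) (fun x => umx (V x m))) ->
  (forall y p x m, mx_in (@rational_fun R)
    (fun s => umx (V (Phi [eta y with p |-> s] * x)%g m))) ->
  (exists g, free (op_family op (assoc_mx t (V g)))) ->
  conull R [set x | free (op_family op (assoc_mx t (V x)))].
Proof.
move=> surj cV rV [g0 g0F].
have g0_free : assoc_det (V g0) != 0 by rewrite -free_assocE.
pose Z := [set x | assoc_det (V x) = 0].
rewrite (_ : mkset _ = ~` Z); last first.
  by apply/seteqP; split => x /=; rewrite free_assocE => /eqP.
apply: (conull_setC _ surj).
- apply: closed_continuous_fun0.
  exact: (conj_ring_assoc_det (@conj_ring_continuous G C)).
- by exists g0; apply/eqP.
move=> y p x /eqP Zx.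
(* Giving the parameter [p] its own value [y p] changes nothing, so the rational function is
   non-zero at [s = y p]. *)
have yE : [eta y with p |-> y p] = y :> (P -> R).
  by apply/funext => q /=; case: eqP => [->|].
have rdet := conj_ring_assoc_det (conj_ring_rational R) (rV y p x).
have : \forall k \near \oo,
    assoc_det (V (Phi [eta y with p |-> k%:R] * x)%g) != 0.
  by apply: (rational_near_neq0 (s := y p) rdet); rewrite /= yE.
by apply: filterS => k /eqP.
Qed.

Lemma conull_free_unitary :
  (exists W : U, free (op_family op (assoc_mx t [ffun=> W]))) ->
  conull R [set W : U | free (op_family op (assoc_mx t [ffun=> W]))].
Proof.
apply: (conull_free (@unitary_param_surj R n)) => [m|y p x m].
  by under eq_fun do rewrite ffunE; exact: continuous_unitary_entry.
under eq_fun do rewrite ffunE.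
apply: (mx_inM (conj_ring_rational R)); first exact: rational_unitary_param.
exact: (mx_in_cst (conj_ring_rational R)).
Qed.

(** The map [c] is the identity for arbitrary tuples and the index of the block for a partition. *)
Lemma conull_free_ffun (I : finType) (c : 'I_n.+1 -> I) :
  (exists W : U, free (op_family op (assoc_mx t [ffun=> W]))) ->
  conull R [set W : {ffun I -> U} |
    free (op_family op (assoc_mx t [ffun m => W (c m)]))].
Proof.
move=> [W W_free].
pose Phi (y : I * uparam n -> R) : {ffun I -> U} :=
  [ffun i => unitary_param (fun p => y (i, p))].
apply: (@conull_free _ _ Phi (fun W => [ffun m => W (c m)])).
- move=> g; have [y yE] := choice (fun i => unitary_param_surj (g i)).
  exists (fun p => y p.1 p.2); apply/ffunP => i; rewrite ffunE /=.
  exact: yE.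
- move=> m; under eq_fun do rewrite ffunE.
  exact: continuous_ffun_unitary_entry.
- move=> y [i p] x m; under eq_fun do rewrite ffunE /= !ffunE.
  apply: (mx_inM (conj_ring_rational R)); last first.
    exact: (mx_in_cst (conj_ring_rational R)).
  (* Freeing a coordinate of component [i] leaves the other components constant. *)
  have [<-|ci] := eqVneq (c m) i; last first.
    rewrite (_ : (fun _ => _) =
        fun=> umx (unitary_param (fun q => y (c m, q)))).
      exact: (mx_in_cst (conj_ring_rational R)).
    apply/funext => s; congr (umx (unitary_param _)); apply/funext => q /=.
    by rewrite xpair_eqE (negbTE ci).
  rewrite (_ : (fun _ => _) = fun s => umx (unitary_param
      [eta (fun q => y (c m, q)) with p |-> s])).
    exact: (rational_unitary_param (fun q => y (c m, q)) p).
  apply/funext => s; congr (umx (unitary_param _)); apply/funext => q /=.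
  by rewrite xpair_eqE eqxx.
exists [ffun=> W]; rewrite (_ : [ffun _ => _] = [ffun=> W])//.
by apply/ffunP => m; rewrite !ffunE.
Qed.

(** Covering puts each [m] in a block; disjointness and the injectivity of [J] make its index [c m]
    unique. This forces [V] to be [[ffun m => W (c m)]]. *)
Lemma conull_free_partition (kappa : nat) (J : 'I_kappa -> {set 'I_n.+1}) :
  injective J ->
  finset.partition [set J j | j : 'I_kappa]%SET [set: 'I_n.+1]%SET ->
  (exists W : U, free (op_family op (assoc_mx t [ffun=> W]))) ->
  conull R [set W : {ffun 'I_kappa -> U} |
    exists2 V : {ffun 'I_n.+1 -> U}, (forall j m, m \in J j -> V m = W j) &
      free (op_family op (assoc_mx t V))].
Proof.
move=> J_inj /and3P[/eqP covJ trivJ _] exW.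
have /choice[c Jc] : forall m, exists j, m \in J j.
  move=> m; have : m \in finset.cover [set J j | j : 'I_kappa]%SET.
    by rewrite covJ inE.
  by case/finset.bigcupP => _ /imsetP[j _ ->]; exists j.
have cJ j m : m \in J j -> c m = j.
  move=> mj; apply: J_inj.
  rewrite -(finset.def_pblock trivJ _ (Jc m)) ?imset_f//.
  by rewrite -(finset.def_pblock trivJ _ mj) ?imset_f.
have := conull_free_ffun c exW; congr (conull R _); apply/seteqP; split=> W /=.
  by move=> W_free; exists [ffun m => W (c m)] => // j m /cJ <-; rewrite ffunE.
move=> [V VW]; rewrite (_ : V = [ffun m => W (c m)])//.
by apply/ffunP => m; rewrite ffunE (VW (c m)).
Qed.

Lemma conull_free_all :
  (exists W : U, free (op_family op (assoc_mx t [ffun=> W]))) ->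
  [/\ conull R [set V : {ffun 'I_n.+1 -> U} |
        free (op_family op (assoc_mx t V))],
      forall (kappa : nat) (J : 'I_kappa -> {set 'I_n.+1}), injective J ->
        finset.partition [set J j | j : 'I_kappa]%SET [set: 'I_n.+1]%SET ->
        conull R [set W : {ffun 'I_kappa -> U} |
          exists2 V : {ffun 'I_n.+1 -> U},
            (forall j m, m \in J j -> V m = W j) &
            free (op_family op (assoc_mx t V))] &
      conull R [set W : U | free (op_family op (assoc_mx t [ffun=> W]))]].
Proof.
move=> exW; split.
- rewrite (_ : mkset _ = [set V : {ffun 'I_n.+1 -> U} |
      free (op_family op (assoc_mx t [ffun m => V (id m)]))]).
    exact: conull_free_ffun.
  apply: eq_set => V; rewrite (_ : [ffun m => V (id m)] = V)//.
  by apply/ffunP => m; rewrite ffunE.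
- by move=> kappa J J_inj Jpart; exact: conull_free_partition.
- exact: conull_free_unitary.
Qed.

End ConullFree.

Theorem theorem3p8 (R : realType) (n : nat) (t : R)
    (hd : (3 <= n.+1)%N) (ht : -1 < t < 1) :
  ((exists W : unitary R[i] n, free_star_left (assoc_mx t [ffun=> W])) ->
    [/\ conull R [set V : {ffun 'I_n.+1 -> unitary R[i] n} |
          free_star_left (assoc_mx t V)],
        forall (kappa : nat) (J : 'I_kappa -> {set 'I_n.+1}),
          injective J -> finset.partition [set J j | j : 'I_kappa] [set: 'I_n.+1] ->
          conull R [set W : {ffun 'I_kappa -> unitary R[i] n} |
            exists2 V : {ffun 'I_n.+1 -> unitary R[i] n},
              (forall j m, m \in J j -> V m = W j) &
              free_star_left (assoc_mx t V)] &
        conull R [set V : unitary R[i] n |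
          free_star_left (assoc_mx t [ffun=> V])]]) /\
  ((exists W : unitary R[i] n, free_star_right (assoc_mx t [ffun=> W])) ->
    [/\ conull R [set V : {ffun 'I_n.+1 -> unitary R[i] n} |
          free_star_right (assoc_mx t V)],
        forall (kappa : nat) (J : 'I_kappa -> {set 'I_n.+1}),
          injective J -> finset.partition [set J j | j : 'I_kappa] [set: 'I_n.+1] ->
          conull R [set W : {ffun 'I_kappa -> unitary R[i] n} |
            exists2 V : {ffun 'I_n.+1 -> unitary R[i] n},
              (forall j m, m \in J j -> V m = W j) &
              free_star_right (assoc_mx t V)] &
        conull R [set V : unitary R[i] n |
          free_star_right (assoc_mx t [ffun=> V])]]).
Proof.
split.
  apply: (conull_free_all (op := fun A B => A ^t* *m B)) => T Q hQ A B QA QB.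
  by apply: (mx_inM hQ) => //; exact: (mx_in_trC hQ).
apply: (conull_free_all (op := fun A B => A *m B ^t*)) => T Q hQ A B QA QB.
by apply: (mx_inM hQ) => //; exact: (mx_in_trC hQ).
Qed.
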